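(* Let $G_1$ and $G_2$ be finite simple graphs, where $G_i$ has $n_i$ vertices, $m_i$ edges, minimum degree $\delta_{G_i}$ and maximum degree $\Delta_{G_i}$ ($i=1,2$). Then $\alpha_1 \leq EU(G_1\circ G_2)\leq \alpha_2$, where $$\alpha_1=\sqrt{3}\,m_1(\delta_{G_1}+n_2)+\sqrt{3}\,n_1m_2(\delta_{G_2}+1)+n_1n_2\{(\delta_{G_1}+n_2)^2+(\delta_{G_2}+1)^2+(\delta_{G_1}+n_2)(\delta_{G_2}+1)\}^{\frac{1}{2}},$$ $$\alpha_2=\sqrt{3}\,m_1(\Delta_{G_1}+n_2)+\sqrt{3}\,n_1m_2(\Delta_{G_2}+1)+n_1n_2\{(\Delta_{G_1}+n_2)^2+(\Delta_{G_2}+1)^2+(\Delta_{G_1}+n_2)(\Delta_{G_2}+1)\}^{\frac{1}{2}}.$$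
   Context: For a graph $G$ and vertex $u$, $d(u)$ denotes the degree of $u$ in $G$. The Euler Sombor index of a graph $G$ is $EU(G)=\sum_{uv\in E(G)}\sqrt{d(u)^2+d(v)^2+d(u)d(v)}$. The corona product $G_1\circ G_2$, where $G_1$ has vertices $u_1,\dots,u_{n_1}$, is the graph obtained by taking $G_1$ together with $n_1$ vertex-disjoint copies of $G_2$ and joining the vertex $u_i$ of $G_1$ by an edge to every vertex of the $i$-th copy of $G_2$, for $i=1,\dots,n_1$. *)

(* Defs.v *)
From mathcomp Require Import all_boot all_order all_algebra.

Set Implicit Arguments.
Unset Strict Implicit.
Unset Printing Implicit Defensive.

Import Order.TTheory GRing.Theory Num.Theory.

Local Open Scope ring_scope.

Record sgraph := SGraph {
  vertex :> finType;
  adj : rel vertex;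
  adj_sym : symmetric adj;
  adj_irrefl : irreflexive adj }.

Section Graph.
Variable G : sgraph.

Definition deg (u : G) : nat := #|[set v | adj u v]|.

Definition edges : {set {set G}} :=
  [set e | [exists u, exists v, adj u v && (e == [set u; v])]].

Definition max_degree : nat := \max_(u : G) deg u.

(* The default value #|G| exceeds every degree, so it is only returned by the
   graph without vertices (see min_degree_attained). *)
Definition min_degree : nat := \big[minn/#|G|]_(u : G) deg u.

Lemma deg_lt (u : G) : (deg u < #|G|)%N.
Proof.
rewrite -cardsT; apply: proper_card; rewrite properT.
by apply/eqP => /setP/(_ u); rewrite !inE adj_irrefl.
Qed.

Lemma min_degree_le (u : G) : (min_degree <= deg u)%N.
Proof.
rewrite /min_degree; have := mem_index_enum u.
elim: (index_enum _) => // v s IHs; rewrite inE big_cons => /predU1P[<-|/IHs].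
  exact: geq_minl.
by apply: leq_trans; apply: geq_minr.
Qed.

Lemma min_degree_attained (u0 : G) : exists u : G, deg u = min_degree.
Proof.
have [v _ vP] := @arg_minnP _ u0 predT deg isT.
exists v; apply/eqP; rewrite eqn_leq min_degree_le andbT /min_degree.
elim/big_ind: _ => [|x y vx vy|w _]; first exact: ltnW (deg_lt v).
  by rewrite leq_min vx.
exact: vP.
Qed.

(* On an edge e = {u, v} the sum is d(u)^2 + d(v)^2 and the product is
   d(u)d(v); see edge_weightE. *)
Definition edge_weight (R : rcfType) (e : {set G}) : R :=
  Num.sqrt (\sum_(w in e) (deg w)%:R ^+ 2 + \prod_(w in e) (deg w)%:R).

Lemma edge_weightE (R : rcfType) (u v : G) : adj u v ->
  edge_weight R [set u; v] =
  Num.sqrt ((deg u)%:R ^+ 2 + (deg v)%:R ^+ 2 + (deg u)%:R * (deg v)%:R).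
Proof.
move=> uv; have nuv : u \notin [set v].
  by rewrite inE; apply: contraTneq uv => ->; rewrite adj_irrefl.
by rewrite /edge_weight !big_setU1 //= !big_set1.
Qed.

Definition euler_sombor (R : rcfType) : R := \sum_(e in edges) edge_weight R e.

End Graph.

Section Corona.
Variables G1 G2 : sgraph.

(* inl u is the vertex u of G1; inr (u, x) is the vertex x in the copy of G2
   attached to u. *)
Definition corona_adj : rel (G1 + G1 * G2)%type := fun a b =>
  match a, b with
  | inl u, inl v => adj u v
  | inl u, inr (v, _) => u == v
  | inr (u, _), inl v => u == v
  | inr (u, x), inr (v, y) => (u == v) && adj x y
  end.

Lemma corona_sym : symmetric corona_adj.
Proof.
by move=> [u|[u x]] [v|[v y]] //=; rewrite 1?adj_sym 1?eq_sym // adj_sym.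
Qed.

Lemma corona_irrefl : irreflexive corona_adj.
Proof. by move=> [u|[u x]] /=; rewrite adj_irrefl ?andbF. Qed.

Definition corona : sgraph := SGraph corona_sym corona_irrefl.

End Corona.

(* Main.v *)
(* Summing over arcs (ordered pairs of adjacent vertices) counts every edge
   twice and splits along the coproduct structure of the vertex set of the
   corona.  The degrees in the corona are d(u) + n2 and d(x) + 1, and
   sqrt (x^2 + y^2 + x y) is monotone in x, y >= 0, so each arc weight is
   bounded by a constant depending only on which of the two kinds of vertices
   its endpoints are. *)
Require Import Defs.
From mathcomp Require Import all_boot all_order all_algebra.
From mathcomp Require Import ring.
Import Order.TTheory GRing.Theory Num.Theory.
Local Open Scope ring_scope.

Lemma max_degree_ge {G : sgraph} (u : G) : (deg u <= max_degree G)%N.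
Proof. exact: leq_bigmax. Qed.

(** In this form degrees in the corona come from the neighbourhood sums below, taken at the constant
    function 1. *)
Lemma degE {G : sgraph} (u : G) : deg u = \sum_(v | adj u v) 1%N.
Proof.
by rewrite sum_nat_const muln1 /deg; apply: eq_card => v; rewrite inE.
Qed.

Lemma adj_neq {G : sgraph} {u v : G} : adj u v -> u != v.
Proof. by apply: contraTneq => ->; rewrite adj_irrefl. Qed.

(** Arcs are grouped by their underlying set. The fibre over an edge [[set u; v]] is exactly
    [(u, v)] and [(v, u)], which differ because there are no loops. *)
Lemma sum_arcs {G : sgraph} {V : nmodType} (F : {set G} -> V) :
  \sum_(u : G) \sum_(v | adj u v) F [set u; v]
  = (\sum_(e in edges G) F e) *+ 2.
Proof.
rewrite pair_big_dep /=.
rewrite (partition_big (fun p : G * G => [set p.1; p.2])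
           [pred e | e \in edges G]) /=; last first.
  move=> [u v] /= uv; rewrite inE.
  by apply/existsP; exists u; apply/existsP; exists v; rewrite uv eqxx.
rewrite -sumrMnl; apply: eq_bigr => e.
rewrite inE => /existsP[u /existsP[v /andP[uv /eqP ->]]].
have nuv := adj_neq uv.
rewrite (eq_bigr (fun=> F [set u; v])); last by move=> p /andP[_ /eqP ->].
rewrite (eq_bigl (mem [set (u, v); (v, u)])); last first.
  move=> [a b]; rewrite !inE !xpair_eqE /=; apply/andP/orP.
    (* Both [a] and [b] lie in [[set u; v]]; of the four resulting cases, [a != b] excludes two. *)
    move=> [ab /eqP E]; have := adj_neq ab.
    have : a \in [set u; v] by rewrite -E set21.
    have : b \in [set u; v] by rewrite -E set22.
    rewrite !inE => /orP[]/eqP-> /orP[]/eqP->; rewrite !eqxx => // _.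
    - by right.
    - by left.
  case=> /andP[/eqP -> /eqP ->]; first by rewrite uv.
  by rewrite adj_sym uv setUC.
by rewrite sumr_const cards2 xpair_eqE negb_and nuv.
Qed.

Lemma sum_arcs_const {G : sgraph} {V : nmodType} (c : V) :
  \sum_(u : G) \sum_(v | adj u v) c = c *+ (2 * #|edges G|).
Proof. by rewrite (sum_arcs (fun=> c)) sumr_const mulnC mulrnA. Qed.

Section CoronaSums.
Context {G1 G2 : sgraph}.
Implicit Types (a b : corona G1 G2).

Lemma sum_corona_nbhd_inl {V : nmodType} (F : corona G1 G2 -> V) (u : G1) :
  \sum_(b | adj (inl u : corona G1 G2) b) F b
  = \sum_(v | adj u v) F (inl v) + \sum_(x : G2) F (inr (u, x)).
Proof.
rewrite big_sumType /=; congr (_ + _).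
(* Only the copy attached to [u] contributes; the one-term outer sum lets the pair index be
   split. *)
transitivity (\sum_(v | v == u) \sum_x F (inr (v, x)));
  last by rewrite big_pred1_eq.
rewrite pair_big_dep /=; apply: eq_big => [[v x]|[v x] _] //=.
by rewrite andbT eq_sym.
Qed.

Lemma sum_corona_nbhd_inr {V : nmodType} (F : corona G1 G2 -> V) u x :
  \sum_(b | adj (inr (u, x) : corona G1 G2) b) F b
  = F (inl u) + \sum_(y | adj x y) F (inr (u, y)).
Proof.
rewrite big_sumType /=; congr (_ + _).
  by rewrite (eq_bigl (pred1 u)) ?big_pred1_eq // => v; rewrite /= eq_sym.
transitivity (\sum_(v | v == u) \sum_(y | adj x y) F (inr (v, y)));
  last by rewrite big_pred1_eq.
rewrite pair_big_dep /=; apply: eq_big => [[v y]|[v y] _] //=.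
by rewrite eq_sym.
Qed.

Lemma deg_corona_inl (u : G1) :
  deg (inl u : corona G1 G2) = (deg u + #|G2|)%N.
Proof.
by rewrite !degE (sum_corona_nbhd_inl (fun=> 1%N)) !sum_nat_const !muln1.
Qed.

Lemma deg_corona_inr (u : G1) (x : G2) :
  deg (inr (u, x) : corona G1 G2) = (deg x + 1)%N.
Proof. by rewrite !degE (sum_corona_nbhd_inr (fun=> 1%N)) [RHS]addnC. Qed.

Definition is_inl a : bool := if a is inl _ then true else false.

(** Each edge of [G1], and each edge of [G2] in each of the [#|G1|] copies, yields two arcs of the
    same kind. Each of the [#|G1| * #|G2|] joining edges yields one arc in each direction. *)
Lemma sum_corona_arcs {V : nmodType} (c : bool -> bool -> V) :
  \sum_a \sum_(b | adj a b) c (is_inl a) (is_inl b)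
  = c true true *+ (2 * #|edges G1|)
    + c false false *+ (2 * (#|G1| * #|edges G2|))
    + (c true false + c false true) *+ (#|G1| * #|G2|).
Proof.
rewrite big_sumType /=.
under eq_bigr do rewrite sum_corona_nbhd_inl /=.
rewrite big_split /= sum_arcs_const !sumr_const.
rewrite (eq_bigr (fun p => c false true + \sum_(y | adj p.2 y) c false false));
  last by move=> [u x] _; rewrite sum_corona_nbhd_inr.
rewrite big_split /= sumr_const card_prod.
rewrite -(pair_bigA _ (fun (u : G1) (x : G2) =>
            \sum_(y | adj x y) c false false)) /=.
rewrite sum_arcs_const sumr_const -!mulrnA mulrnDl.
rewrite [(#|G2| * _)%N]mulnC -mulnA [(_ * #|G1|)%N]mulnC.
by rewrite -!addrA; congr (_ + _); rewrite addrA addrC.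
Qed.

End CoronaSums.

Section Weight.
Context {R : rcfType}.
Implicit Types x y : R.

Definition weight x y : R := Num.sqrt (x ^+ 2 + y ^+ 2 + x * y).

Lemma weightC x y : weight x y = weight y x.
Proof. by rewrite /weight [x ^+ 2 + _]addrC [x * y]mulrC. Qed.

(** The radicand is [3 * x ^+ 2]; this is the source of the factors [Num.sqrt 3] in both bounds. *)
Lemma weight_diag x : 0 <= x -> weight x x = Num.sqrt 3 * x.
Proof.
move=> x0; rewrite /weight -[in RHS](ger0_norm x0) -sqrtr_sqr -sqrtrM //.
by congr Num.sqrt; ring.
Qed.

Lemma ler_weight x y x' y' : 0 <= x -> 0 <= y -> x <= x' -> y <= y' ->
  weight x y <= weight x' y'.
Proof.
move=> x0 y0 xx yy; apply: ler_wsqrtr.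
by rewrite !lerD ?ler_pM // lerXn2r // nnegrE //
   ?(le_trans _ xx) ?(le_trans _ yy).
Qed.

Lemma sum_arcs_weight (G : sgraph) :
  \sum_(u : G) \sum_(v | adj u v) weight (deg u)%:R (deg v)%:R
  = euler_sombor G R *+ 2.
Proof.
rewrite -sum_arcs; apply: eq_bigr => u _; apply: eq_bigr => v uv.
by rewrite edge_weightE.
Qed.

(** With [d1], [d2] set to the extreme degrees in the corona, the right-hand side is twice [alpha1]
    or twice [alpha2]. *)
Lemma sum_corona_weight (G1 G2 : sgraph) (d1 d2 : R) : 0 <= d1 -> 0 <= d2 ->
  \sum_(a : corona G1 G2) \sum_(b | adj a b)
    weight (if is_inl a then d1 else d2) (if is_inl b then d1 else d2)
  = (Num.sqrt 3 * #|edges G1|%:R * d1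
     + Num.sqrt 3 * #|G1|%:R * #|edges G2|%:R * d2
     + #|G1|%:R * #|G2|%:R * weight d1 d2) *+ 2.
Proof.
move=> d1_ge0 d2_ge0.
rewrite (sum_corona_arcs (fun s t =>
           weight (if s then d1 else d2) (if t then d1 else d2))).
rewrite [weight d2 d1]weightC !weight_diag //.
rewrite -(mulr_natr _ (2 * #|edges G1|)) -(mulr_natr _ (2 * (_ * _))).
by rewrite -(mulr_natr _ (#|G1| * #|G2|)) !natrM; ring.
Qed.

End Weight.

Theorem theorem4 (R : rcfType) (G1 G2 : sgraph) :
  let n1 : R := #|G1|%:R in
  let n2 : R := #|G2|%:R in
  let m1 : R := #|edges G1|%:R in
  let m2 : R := #|edges G2|%:R in
  let delta1 : R := (min_degree G1)%:R in
  let delta2 : R := (min_degree G2)%:R in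
  let Delta1 : R := (max_degree G1)%:R in
  let Delta2 : R := (max_degree G2)%:R in
  let alpha1 : R :=
    Num.sqrt 3 * m1 * (delta1 + n2) + Num.sqrt 3 * n1 * m2 * (delta2 + 1)
    + n1 * n2 * Num.sqrt ((delta1 + n2) ^+ 2 + (delta2 + 1) ^+ 2
                          + (delta1 + n2) * (delta2 + 1)) in
  let alpha2 : R :=
    Num.sqrt 3 * m1 * (Delta1 + n2) + Num.sqrt 3 * n1 * m2 * (Delta2 + 1)
    + n1 * n2 * Num.sqrt ((Delta1 + n2) ^+ 2 + (Delta2 + 1) ^+ 2
                          + (Delta1 + n2) * (Delta2 + 1)) in
  alpha1 <= euler_sombor (corona G1 G2) R
  /\ euler_sombor (corona G1 G2) R <= alpha2.
Proof.
move=> n1 n2 m1 m2 delta1 delta2 Delta1 Delta2 alpha1 alpha2.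
have deg_bounds (a : corona G1 G2) :
    (if is_inl a then delta1 + n2 else delta2 + 1) <= (deg a)%:R
    /\ (deg a)%:R <= (if is_inl a then Delta1 + n2 else Delta2 + 1).
  case: a => [u|[u x]] /=; rewrite ?deg_corona_inl ?deg_corona_inr natrD;
    by rewrite !lerD2r !ler_nat min_degree_le max_degree_ge.
split;
  (* Doubling both sides turns each into a sum over the arcs of the corona, to be compared term by
     term. *)
  rewrite -(ler_pMn2r (ltn0Sn 1)) -sum_arcs_weight -sum_corona_weight;
  rewrite ?addr_ge0 //;
  apply: ler_sum => a _; apply: ler_sum => b _;
  have [la ua] := deg_bounds a; have [lb ub] := deg_bounds b;
  (* Monotonicity asks that the smaller arguments be nonnegative: the constants for the lower bound,
     the degrees for the upper one. *)
  by apply: ler_weight => //; case: is_inl; rewrite addr_ge0.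
Qed.
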